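(* Let $G$ be an absolutely continuous baseline cumulative distribution function with probability density function $g$, and let $\alpha>0$, $a>0$, $b>0$. Let $f$, $F$ and $h$ be the pdf, cdf and hazard rate function of the $MOKw$-$G$ distribution with parameters $\alpha,a,b$ and baseline $G$. Then, as $t\to\infty$, $$f(t)\sim\alpha\,a\,b\,g(t)\,[1-G(t)^a]^{b-1},\qquad F(t)\sim 1-[1-G(t)^a]^b,\qquad h(t)\sim a\,b\,g(t)\,[1-G(t)^a]^{-1}.$$
   Context: With $\bar\alpha=1-\alpha$, the $MOKw$-$G$ (Marshall-Olkin-Kumaraswamy-$G$) distribution has pdf $$f(t)=\frac{\alpha\,a\,b\,g(t)\,G(t)^{a-1}[1-G(t)^a]^{b-1}}{\left[1-\bar\alpha\,[1-G(t)^a]^b\right]^2},$$ cdf $$F(t)=\frac{1-[1-G(t)^a]^b}{1-\bar\alpha\,[1-G(t)^a]^b},$$ and hazard rate function $$h(t)=\frac{f(t)}{1-F(t)}=\frac{a\,b\,g(t)\,G(t)^{a-1}[1-G(t)^a]^{-1}}{1-\bar\alpha\,[1-G(t)^a]^b}.$$ Here $u(t)\sim v(t)$ as $t\to\infty$ means $u(t)=(1+o(1))\,v(t)$ as $t\to\infty$, where $t$ ranges over points with $0<G(t)<1$. *)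

(* Defs.v *)
(* MathComp-Analysis. *)
From HB Require Import structures.
From mathcomp Require Import all_boot all_order all_algebra.
From mathcomp Require Import all_classical all_reals all_analysis.

Set Implicit Arguments.
Unset Strict Implicit.
Unset Printing Implicit Defensive.

Import Order.TTheory GRing.Theory Num.Theory.
Import numFieldNormedType.Exports.

Local Open Scope classical_set_scope.
Local Open Scope ring_scope.

(* A cumulative distribution function G is absolutely continuous exactly when
   it has such a density; that g has total mass 1 follows from G --> 1 at +oo. *)
Definition has_density (R : realType) (G g : R -> R) : Prop :=
  [/\ measurable_fun [set: R] g,
      forall x, 0 <= g x &
      forall t, (G t)%:E =
        (\int[lebesgue_measure]_(x in `]-oo, t]) (g x)%:E)%E].

Section MOKw.
Variables (R : realType) (alpha a b : R) (G g : R -> R).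

Definition mokw_pdf (t : R) : R :=
  (alpha * a * b * g t * G t `^ (a - 1) * (1 - G t `^ a) `^ (b - 1)) /
  (1 - (1 - alpha) * (1 - G t `^ a) `^ b) ^+ 2.

Definition mokw_cdf (t : R) : R :=
  (1 - (1 - G t `^ a) `^ b) / (1 - (1 - alpha) * (1 - G t `^ a) `^ b).

Definition mokw_hazard (t : R) : R := mokw_pdf t / (1 - mokw_cdf t).

End MOKw.

(* u = (1 + o(1)) v along the filter F. *)
Definition asymp_equiv (R : realType) (F : set_system R) (u v : R -> R) : Prop :=
  exists2 e : R -> R, e t @[t --> F] --> (0 : R) &
    \forall t \near F, u t = (1 + e t) * v t.

(* t --> +oo through the points with 0 < G t < 1; this filter is improper when
   G reaches 1 at a finite point. *)
Definition infty_within_support (R : realType) (G : R -> R) : set_system R :=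
  within [set t | 0 < G t < 1] (+oo : set_system R).

(* Main.v *)
Require Import Defs.
From HB Require Import structures.
From mathcomp Require Import all_boot all_order all_algebra.
From mathcomp Require Import all_classical all_reals all_analysis.
From mathcomp Require Import ring.

Import Order.TTheory GRing.Theory Num.Theory.
Import numFieldNormedType.Exports.

Local Open Scope classical_set_scope.
Local Open Scope ring_scope.

(** Put [S = (1 - G `^ a) `^ b], the survival function of the Kumaraswamy-G
    distribution, and [D = 1 - (1 - alpha) * S].  As [t] grows, [G t] tends to
    [1], hence [S] tends to [0] and [D] to [1].  Each of the three functions is
    the claimed equivalent times an explicit factor:
    - the pdf has the factor [G `^ (a - 1) / D ^+ 2];
    - the cdf has the factor [D^-1];
    - the hazard rate has the factor [G `^ (a - 1) / D], because
      [1 - F = alpha * S / D] and [(1 - G `^ a) `^ (b - 1) / S] is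
      [(1 - G `^ a)^-1] ([mokw_hazardE]).
    All these factors tend to [1], which is the definition of equivalence
    ([asymp_equiv_factor]).

    The condition [0 < G t < 1] makes [1 - G t `^ a] positive.  This is what
    makes [S] tend to [0], a real power being continuous at [0] only from the
    right, and what allows dividing by [S] in the hazard rate. *)

Lemma asymp_equiv_factor {R : realType} {F : set_system R} {FF : Filter F}
    {m u v : R -> R} :
  m t @[t --> F] --> (1 : R) -> (\forall t \near F, u t = m t * v t) ->
  asymp_equiv F u v.
Proof.
move=> m1 um; exists (fun t => m t - 1).
  by rewrite -(subrr (1 : R)); apply: cvgB => //; exact: cvg_cst.
by apply: filterS um => t ->; rewrite subrKC.
Qed.

Lemma cvg_powR1 (R : realType) (T : Type) (F : set_system T) (FF : Filter F)
    (f : T -> R) (p : R) :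
  f t @[t --> F] --> (1 : R) -> f t `^ p @[t --> F] --> (1 : R).
Proof.
move=> f1; have <- : 1 `^ p = 1 :> R by rewrite powR1.
apply: (@cvg_comp _ _ _ f (fun x => x `^ p) _ _ _ f1).
apply: (@differentiable_continuous _ R R 1 (fun x => x `^ p)).
by apply/derivable1_diffP/derivable_powR; rewrite in_itv/= ltr01.
Qed.

(** The sign condition is there because a negative base has power [1], so that
    the power is discontinuous at [0] from the left. *)
Lemma cvg_powR0 (R : realType) (T : Type) (F : set_system T) (FF : Filter F)
    (f : T -> R) (p : R) :
  0 < p -> (\forall t \near F, 0 < f t) -> f t @[t --> F] --> (0 : R) ->
  f t `^ p @[t --> F] --> (0 : R).
Proof.
move=> p0 fpos f0.
apply: (@cvg_comp _ _ _ f (fun x => x `^ p) _ _ _ _ (powR_cvg0 p0)).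
move=> A /f0 fA; apply: filterS2 fpos fA => t ft; exact.
Qed.

Section Mokw.
Context {R : realType}.
Variables (alpha a b : R).

Definition mokw_den (x : R) : R := 1 - (1 - alpha) * (1 - x `^ a) `^ b.

Lemma subr1_powR_gt0 (x : R) : 0 < a -> 0 < x < 1 -> 0 < 1 - x `^ a.
Proof.
move=> a0 /andP[x0 x1]; rewrite subr_gt0.
have <- : 1 `^ a = 1 :> R by rewrite powR1.
by rewrite gt0_ltr_powR// nnegrE ?ltW.
Qed.

Lemma cvg_mokw_den (F : set_system R) (FF : Filter F) (G : R -> R) :
  0 < a -> 0 < b -> (\forall t \near F, 0 < G t < 1) ->
  G t @[t --> F] --> (1 : R) -> mokw_den (G t) @[t --> F] --> (1 : R).
Proof.
move=> a0 b0 G01 G1.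
have S0 : (1 - G t `^ a) `^ b @[t --> F] --> (0 : R).
  apply: cvg_powR0 => //.
    by apply: filterS G01 => t; exact: subr1_powR_gt0.
  rewrite -(subrr (1 : R)).
  by apply: cvgB; [exact: cvg_cst | exact: cvg_powR1].
rewrite -[X in _ --> X]subr0 -(mulr0 (1 - alpha)).
by apply: cvgB; [exact: cvg_cst | apply: cvgM => //; exact: cvg_cst].
Qed.

(** The complement [1 - F] equals [alpha * S / D]: its [alpha] cancels the one in
    the pdf, its [D^-1] leaves a single [D] in the denominator, and its [S]
    lowers the power [b - 1] of [1 - G t `^ a] to [-1]. *)
Lemma mokw_hazardE (G g : R -> R) (t : R) :
  0 < alpha -> 0 < 1 - G t `^ a -> mokw_den (G t) != 0 ->
  mokw_hazard alpha a b G g t =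
  (G t `^ (a - 1) / mokw_den (G t)) * (a * b * g t * (1 - G t `^ a)^-1).
Proof.
rewrite /mokw_hazard /mokw_pdf /mokw_cdf /mokw_den => alpha0 y0.
rewrite [_ `^ (b - 1)]powRB ?(gt_eqF y0) ?implybT// (powRr1 (ltW y0)).
have := powR_gt0 b y0; move: (G t `^ (a - 1)) => w.
move: (_ `^ b) y0 => S; move: (1 - G t `^ a) => y y0 S0 D0.
have SD : 1 - (1 - alpha) * S - (1 - S) = alpha * S by ring.
by field; rewrite SD D0 mulf_neq0 !lt0r_neq0.
Qed.

End Mokw.

Theorem proposition2 (R : realType) (G : cumulativeBounded (0 : R) (1 : R))
    (g : R -> R) (alpha a b : R)
    (hg : has_density G g)
    (halpha : 0 < alpha) (ha : 0 < a) (hb : 0 < b) :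
  [/\ asymp_equiv (infty_within_support G) (mokw_pdf alpha a b G g)
        (fun t => alpha * a * b * g t * (1 - G t `^ a) `^ (b - 1)),
      asymp_equiv (infty_within_support G) (mokw_cdf alpha a b G)
        (fun t => 1 - (1 - G t `^ a) `^ b) &
      asymp_equiv (infty_within_support G) (mokw_hazard alpha a b G g)
        (fun t => a * b * g t * (1 - G t `^ a)^-1)].
Proof.
set F := infty_within_support G.
have FF : Filter F by exact: within_filter.
have G01 : \forall t \near F, 0 < G t < 1 by apply: withinT.
have G1 : G t @[t --> F] --> (1 : R).
  by apply: cvg_within_filter; exact: cumulativey.
have D1 := cvg_mokw_den alpha a b F FF G ha hb G01 G1.
have Ga : G t `^ (a - 1) @[t --> F] --> (1 : R).
  exact: cvg_powR1.
have V1 : (mokw_den alpha a b (G t))^-1 @[t --> F] --> (1 : R).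
  by have := @cvgV _ _ _ _ _ _ (oner_neq0 R) D1; rewrite invr1; apply.
split.
- have := cvgM Ga (cvgM V1 V1); rewrite !mulr1 => /(_ FF FF).
  move=> /asymp_equiv_factor; apply.
  by apply: nearW => t; rewrite /mokw_pdf expr2 invfM /=; ring.
- apply: (asymp_equiv_factor V1).
  by apply: nearW => t; rewrite /mokw_cdf mulrC.
- have := cvgM Ga V1; rewrite mulr1 => /(_ FF) /asymp_equiv_factor; apply.
  have Dn0 : \forall t \near F, mokw_den alpha a b (G t) != 0.
    by apply: filterS (cvgr_gt _ D1 _ ltr01) => t /gt_eqF ->.
  apply: filterS2 G01 Dn0 => t Gt01 Dt0.
  by apply: mokw_hazardE => //; exact: subr1_powR_gt0.
Qed.
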